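(* Let $n\ge 0$ be an integer and let $h(x)=h_0+h_1x+\cdots+h_nx^n$ be a real polynomial that is symmetric with center of symmetry $n/2$, i.e. $h_i=h_{n-i}$ for all $0\le i\le n$ (the degree of $h$ may be less than $n$). Write $h(x)=\sum_{i=0}^{\lfloor n/2\rfloor}\gamma_i\,x^i(1+x)^{n-2i}$ and $\gamma_h(x)=\gamma_0+\gamma_1x+\cdots+\gamma_{\lfloor n/2\rfloor}x^{\lfloor n/2\rfloor}$. If $\gamma_h(x)$ is log-concave and has no internal zeros, then $h(x)$ is log-concave and has no internal zeros.
   Context: Every polynomial symmetric with center $n/2$ can be written uniquely as $\sum_{i=0}^{\lfloor n/2\rfloor}\gamma_i x^i(1+x)^{n-2i}$; the polynomial $\gamma_h(x)=\sum_i\gamma_ix^i$ is its $\gamma$-polynomial. A polynomial $a_0+a_1x+\cdots+a_mx^m$ with nonnegative coefficients is called log-concave if $a_i^2\ge a_{i-1}a_{i+1}$ for all $0<i<m$ (being log-concave includes having nonnegative coefficients). It has no internal zeros if $a_ia_j\neq0$ with $i<j$ implies $a_k\ne0$ for all $i\le k\le j$. *)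

(* Defs.v *)
From HB Require Import structures.
From mathcomp Require Import all_boot all_order all_algebra.

Set Implicit Arguments.
Unset Strict Implicit.
Unset Printing Implicit Defensive.

Import Order.TTheory GRing.Theory Num.Theory.
Local Open Scope ring_scope.

(* The degree of h may be smaller than n; coefficients beyond it are 0. *)
Definition symmetric_poly (R : nzRingType) (n : nat) (h : {poly R}) : Prop :=
  (size h <= n.+1)%N /\ forall i : nat, (i <= n)%N -> h`_i = h`_(n - i).

(* This determines g uniquely for symmetric h: see gamma_polynomial_exists
   and gamma_polynomial_unique. *)
Definition is_gamma_polynomial (R : nzRingType) (n : nat) (h g : {poly R}) :
    Prop :=
  (size g <= n./2.+1)%N /\
  h = \sum_(i < n./2.+1) g`_i *: ('X^i * (1 + 'X) ^+ (n - 2 * i)).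

(* The upper bound m of the coefficient range is taken to be the degree: for
   i >= deg p the inequality reads 0 <= p`_i ^+ 2. *)
Definition log_concave (R : numDomainType) (p : {poly R}) : Prop :=
  (forall i : nat, 0 <= p`_i) /\
  (forall i : nat, (0 < i < (size p).-1)%N ->
     p`_i.-1 * p`_i.+1 <= p`_i ^+ 2).

Definition no_internal_zeros (R : nzRingType) (p : {poly R}) : Prop :=
  forall i j : nat, (i < j)%N -> p`_i * p`_j != 0 ->
  forall k : nat, (i <= k <= j)%N -> p`_k != 0.

Lemma gamma_sum_recl (R : comNzRingType) (n : nat) (g : {poly R}) :
  \sum_(i < n.+2./2.+1) g`_i *: ('X^i * (1 + 'X) ^+ (n.+2 - 2 * i)) =
  g`_0 *: (1 + 'X) ^+ n.+2
  + 'X * \sum_(i < n./2.+1) g`_i.+1 *: ('X^i * (1 + 'X) ^+ (n - 2 * i)).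
Proof.
rewrite big_ord_recl /= muln0 subn0 expr0 mul1r; congr (_ + _).
rewrite big_distrr; apply: eq_bigr => i _ /=.
by rewrite /bump /= add1n mulnS subnDA exprS -scalerAr mulrA subSS subSS subn0.
Qed.

Lemma coef_1DXn (R : comNzRingType) (n k : nat) :
  ((1 + 'X : {poly R}) ^+ n)`_k = 'C(n, k)%:R.
Proof.
rewrite exprDn coef_sum.
under eq_bigr => i _ do rewrite expr1n mul1r coefMn coefXn.
have [lkn|ltnk] := ltnP k n.+1.
  rewrite (bigD1 (Ordinal lkn)) //= eqxx big1 ?addr0 // => i /eqP ni.
  case: eqP => [e|_]; last by rewrite mul0rn.
  by case: ni; apply: val_inj; rewrite /= e.
rewrite bin_small // big1 // => i _.
by rewrite gtn_eqF ?mul0rn // (leq_trans (ltn_ord i)).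
Qed.

Lemma gamma_polynomial_exists (R : comNzRingType) (n : nat) (h : {poly R}) :
  symmetric_poly n h -> exists g : {poly R}, is_gamma_polynomial n h g.
Proof.
have [m] := ubnP n; elim: m n h => // m IH [|[|n]] h ltm [szh symh].
- exists h; split=> //=.
  by rewrite big_ord1 /= expr0 mul1r expr0 alg_polyC -size1_polyC.
- exists (h`_0)%:P; split; first by rewrite /= size_polyC; case: eqP.
  rewrite big_ord1 /= coefC eqxx expr0 mul1r muln0 subn0 expr1.
  apply/polyP => -[|[|k]]; rewrite coefZ coefD coef1 coefX /=.
  + by rewrite addr0 mulr1.
  + by rewrite add0r mulr1 symh.
  + by rewrite addr0 mulr0 nth_default // (leq_trans szh).
pose q := h - h`_0 *: (1 + 'X) ^+ n.+2.
have qE k : q`_k = h`_k - h`_0 * 'C(n.+2, k)%:R.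
  by rewrite coefB coefZ coef_1DXn.
have q0 : q`_0 = 0 by rewrite qE bin0 mulr1 subrr.
pose q1 := \poly_(i < n.+1) q`_i.+1.
have hq : h = h`_0 *: (1 + 'X) ^+ n.+2 + 'X * q1.
  apply/polyP => k; rewrite coefD coefXM coefZ coef_1DXn.
  case: k => [|k] /=; first by rewrite bin0 mulr1 addr0.
  rewrite coef_poly; case: ltnP => [_|le]; first by rewrite qE addrC subrK.
  rewrite addr0; move: le; rewrite leq_eqVlt => /orP[/eqP <-|lt].
    by rewrite binn mulr1 symh // subnn.
  by rewrite bin_small // mulr0 nth_default // (leq_trans szh).
have [|//|g [szg gE]] := IH n q1; first by rewrite -ltnS ltnW.
  split=> [|i lein]; first exact: size_poly.
  rewrite !coef_poly !ltnS lein leq_subr !qE -subSn //.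
  rewrite symh; last by rewrite ltnW.
  rewrite !subSS -{1}bin_sub; last by rewrite ltnW.
  by rewrite !subSS.
exists ((h`_0)%:P + 'X * g); split.
  apply/leq_sizeP => -[//|j] le; rewrite coefD coefC coefXM /= add0r.
  by rewrite nth_default // (leq_trans szg).
rewrite gamma_sum_recl coefD coefC coefXM /= addr0 {1}hq; congr (_ + _ * _).
by rewrite gE; apply: eq_bigr => i _; rewrite coefD coefC coefXM /= add0r.
Qed.

Lemma gamma_polynomial_unique (R : comNzRingType) (n : nat)
    (h g1 g2 : {poly R}) :
  is_gamma_polynomial n h g1 -> is_gamma_polynomial n h g2 -> g1 = g2.
Proof.
have [m] := ubnP n; elim: m n h g1 g2 => // m IH n h g1 g2 ltm.
have base (g : {poly R}) : n./2 = 0%N -> is_gamma_polynomial n h g ->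
    g = (h`_0)%:P.
  move=> n0 [szg ->]; rewrite n0 big_ord1 /= muln0 subn0 expr0 mul1r.
  rewrite coefZ coef_1DXn bin0 mulr1.
  by apply: size1_polyC; rewrite n0 in szg.
case: n ltm base => [|[|n]] ltm base H1 H2;
  try by rewrite (base _ _ H1) // (base _ _ H2).
case: H1 H2 => [sz1 E1] [sz2 E2].
have head (g : {poly R}) :
    h = \sum_(i < n.+2./2.+1) g`_i *: ('X^i * (1 + 'X) ^+ (n.+2 - 2 * i)) ->
    h`_0 = g`_0.
  by rewrite gamma_sum_recl => ->; rewrite coefD coefXM coefZ coef_1DXn
    bin0 mulr1 addr0.
pose t (g : {poly R}) := \poly_(i < n./2.+1) g`_i.+1.
have tE (g : {poly R}) : (size g <= n.+2./2.+1)%N -> forall i, (t g)`_i = g`_i.+1.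
  move=> szg i; rewrite coef_poly; case: ltnP => // le.
  by rewrite nth_default // (leq_trans szg).
pose k := \sum_(i < n./2.+1) g1`_i.+1 *: ('X^i * (1 + 'X) ^+ (n - 2 * i)).
have kE : k = \sum_(i < n./2.+1) g2`_i.+1 *: ('X^i * (1 + 'X) ^+ (n - 2 * i)).
  move: (E1); rewrite E2 !gamma_sum_recl -(head _ E1) -(head _ E2).
  move/addrI/polyP => e; apply/polyP => i.
  by have := e i.+1; rewrite !coefXM.
have tt : t g1 = t g2.
  apply: (IH n k); first by rewrite -ltnS ltnW.
    split; first exact: size_poly.
    by apply: eq_bigr => i _; rewrite tE.
  split; first exact: size_poly.
  by rewrite kE; apply: eq_bigr => i _; rewrite tE.
apply/polyP => -[|i]; first by rewrite -(head _ E1) -(head _ E2).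
by rewrite -!tE // tt.
Qed.

(* Main.v *)
(* Expanding h_k^2 - h_(k-1) h_(k+1) and grouping by i + j gives sums of
   gamma_i gamma_j e(i, j).  As gamma is log-concave without internal zeros,
   gamma_i gamma_j grows towards the middle of each antidiagonal, so it suffices
   that the sums of e over the windows lo <= i <= hi, j = lo + hi - i, are
   nonnegative.
   Put f(z) = C(n - 2hi, z) for z in Z and (B f)(z) = f(z-1) + 2 f(z) + f(z+1).
   The coefficient of x^k in x^i (1+x)^(n-2i) is (B^(hi-i) f)(k - hi), so the
   window sum is the case z = k - hi, m = hi - lo of
     sum_r (B^r f)(z) (B^(m-r) f)(z) >= sum_r (B^r f)(z-1) (B^(m-r) f)(z+1).
   Expanding both sides in products of values of f, the kernel
   sum_r C(2r, r+a) C(2(m-r), m-r+b) depends only on a + b, half of the terms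
   cancel, and a reflection reduces the rest to the log-concavity of f. *)

Require Import Defs.
From HB Require Import structures.
From mathcomp Require Import all_boot all_order all_algebra.
From mathcomp Require Import zify ring.

Set Implicit Arguments.
Unset Strict Implicit.
Unset Printing Implicit Defensive.

Import Order.TTheory GRing.Theory Num.Theory.
Local Open Scope ring_scope.

(** * Central binomial coefficients and their convolutions *)

(** Coefficient of x^a in (x^(-1) + 2 + x)^r; by symmetry only a >= 0 is kept. *)
Definition cbin (r a : nat) : nat := 'C(2 * r, r + a).

Lemma cbin_eq0 r a : (r < a)%N -> cbin r a = 0%N.
Proof. by move=> lt_ra; rewrite /cbin bin_small //; lia. Qed.

Lemma cbinS r a :
  cbin r.+1 a.+1 = (cbin r a + 2 * cbin r a.+1 + cbin r a.+2)%N.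
Proof.
rewrite /cbin (_ : 2 * r.+1 = (2 * r).+2)%N; last lia.
by rewrite addSn !addnS !binS; lia.
Qed.

Lemma cbin_decr r a : (cbin r a.+1 <= cbin r a)%N.
Proof.
have := mul_bin_left (2 * r) (r + a); rewrite /cbin addnS => E.
have : ((r + a).+1 * 'C(2 * r, (r + a).+1) <= (r + a).+1 * 'C(2 * r, r + a))%N.
  by rewrite E leq_mul2r; apply/orP; right; lia.
by rewrite leq_mul2l.
Qed.

Lemma cbin_subr r a : (a <= r)%N -> 'C(2 * r, r - a) = cbin r a.
Proof.
move=> le_ar; rewrite /cbin -bin_sub; last lia.
by congr 'C(_, _); lia.
Qed.

Definition cbin_conv (m a b : nat) : nat :=
  \sum_(r < m.+1) cbin r a * cbin (m - r) b.

Lemma cbin_convC m a b : cbin_conv m a b = cbin_conv m b a.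
Proof.
rewrite /cbin_conv (reindex_inj rev_ord_inj) /=.
apply: eq_bigr => r _; rewrite subSS mulnC.
by rewrite subKn // -ltnS.
Qed.

(** With a positive first index the term [r = 0] vanishes, and [cbinS] expands all the others. *)
Lemma cbin_convS m a b :
  cbin_conv m.+1 a.+1 b =
  (cbin_conv m a b + 2 * cbin_conv m a.+1 b + cbin_conv m a.+2 b)%N.
Proof.
rewrite {1}/cbin_conv big_ord_recl cbin_eq0 // mul0n add0n.
rewrite /cbin_conv big_distrr /= -!big_split /=.
by apply: eq_bigr => r _; rewrite /bump /= add1n cbinS subSS; ring.
Qed.

(* [cbin_conv m a b] counts the visits to a point by walks whose ends lie at
   distances a and b from it on opposite sides, so it depends on a + b only. *)
Lemma cbin_conv_shift m a b : cbin_conv m a b.+1 = cbin_conv m a.+1 b.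
Proof.
elim: m a b => [|m IH] a b.
  rewrite /cbin_conv !big_ord1 (cbin_eq0 (a := a.+1)) //.
  by rewrite (cbin_eq0 (a := b.+1)) // muln0.
rewrite cbin_convC !cbin_convS !(cbin_convC m _ a).
by rewrite !IH.
Qed.

Lemma cbin_conv_decr m a b : (cbin_conv m a.+1 b.+1 <= cbin_conv m a b)%N.
Proof. by apply: leq_sum => r _; apply: leq_mul; apply: cbin_decr. Qed.

(** * The operator B^r *)

Lemma sum_ord_trunc (V : nmodType) (n N : nat) (u : nat -> V) :
  (n <= N)%N -> (forall i, (n <= i)%N -> u i = 0) ->
  \sum_(i < N) u i = \sum_(i < n) u i.
Proof.
move=> /subnKC <- u0; rewrite big_split_ord /= [X in _ + X]big1 ?addr0 //.
by move=> i _; apply: u0; apply: leq_addr.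
Qed.

Section BinomialTransform.
Variables (R : realDomainType) (f : int -> R).

(** B^r f written out: B is (1 + T)^2 / T for the shift T, hence row 2r of Pascal's triangle. *)
Definition btrans (r : nat) (z : int) : R :=
  \sum_(i < (2 * r).+1) 'C(2 * r, i)%:R * f (z + r%:Z - i%:Z).

(** The values of f are split into those from z upwards and those from z - 1 downwards; the bound m,
    common to all r, lets sums over r and a be exchanged. *)
Lemma btrans_split m r z : (r <= m)%N ->
  btrans r z = \sum_(a < m.+1) ((cbin r a)%:R * f (z + a%:Z)
                              + (cbin r a.+1)%:R * f (z - 1 - a%:Z)).
Proof.
move=> le_rm; rewrite big_split /=.
rewrite (@sum_ord_trunc _ r.+1 m.+1 (fun a => (cbin r a)%:R * f (z + a%:Z))) //;
  last by move=> i ?; rewrite cbin_eq0 ?mul0r.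
rewrite (@sum_ord_trunc _ r m.+1
           (fun a => (cbin r a.+1)%:R * f (z - 1 - a%:Z))); first last.
- by move=> i ?; rewrite cbin_eq0 ?mul0r.
- exact: leqW.
rewrite /btrans.
rewrite -(big_mkord xpredT (fun i => 'C(2 * r, i)%:R * f (z + r%:Z - i%:Z))).
rewrite (_ : (2 * r).+1 = r.+1 + r)%N ?big_mkord ?big_split_ord /=; last lia.
congr (_ + _).
  rewrite (reindex_inj rev_ord_inj) /=; apply: eq_bigr => a _.
  have le_ar : (a <= r)%N by rewrite -ltnS.
  rewrite subSS cbin_subr //; congr (_ * f _); lia.
apply: eq_bigr => a _; rewrite /cbin addnS; congr (_ * f _); lia.
Qed.

(** The same two half-lines as for z, with the coefficients swapped, so that products can be
    compared. *)
Lemma btrans_split_pred m r z : (r <= m)%N ->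
  btrans r (z - 1) = \sum_(a < m.+1) ((cbin r a.+1)%:R * f (z + a%:Z)
                                    + (cbin r a)%:R * f (z - 1 - a%:Z)).
Proof.
move=> le_rm; rewrite big_split /=.
rewrite (@sum_ord_trunc _ r.+1 m.+1 (fun a => (cbin r a)%:R * f (z - 1 - a%:Z))) //;
  last by move=> i ?; rewrite cbin_eq0 ?mul0r.
rewrite (@sum_ord_trunc _ r m.+1
           (fun a => (cbin r a.+1)%:R * f (z + a%:Z))); first last.
- by move=> i ?; rewrite cbin_eq0 ?mul0r.
- exact: leqW.
rewrite /btrans.
rewrite -(big_mkord xpredT (fun i => 'C(2 * r, i)%:R * f (z - 1 + r%:Z - i%:Z))).
rewrite (_ : (2 * r).+1 = r + r.+1)%N ?big_mkord ?big_split_ord /=; last lia.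
congr (_ + _).
  rewrite (reindex_inj rev_ord_inj) /=; apply: eq_bigr => a _.
  rewrite cbin_subr //; congr (_ * f _); have := ltn_ord a; lia.
apply: eq_bigr => a _; rewrite /cbin; congr (_ * f _); lia.
Qed.

Hypothesis f_lc : forall (z : int) (a b : nat),
  f (z + 1 + a%:Z) * f (z - 1 - b%:Z) <= f (z + a%:Z) * f (z - b%:Z).

Lemma btrans_conv_ge m z :
  0 <= \sum_(r < m.+1) (btrans r z * btrans (m - r) z
                        - btrans r (z - 1) * btrans (m - r) (z + 1)).
Proof.
pose d a b : R := (cbin_conv m a b)%:R - (cbin_conv m a.+1 b.+1)%:R.
have -> : \sum_(r < m.+1) (btrans r z * btrans (m - r) z
                        - btrans r (z - 1) * btrans (m - r) (z + 1)) =
  \sum_(a < m.+1) \sum_(b < m.+1) d a b *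
     (f (z + a%:Z) * f (z - b%:Z) - f (z - 1 - a%:Z) * f (z + 1 + b%:Z)).
  transitivity (\sum_(r < m.+1) \sum_(a < m.+1) \sum_(b < m.+1)
     (((cbin r a)%:R * (cbin (m - r) b)%:R
       - (cbin r a.+1)%:R * (cbin (m - r) b.+1)%:R) *
      (f (z + a%:Z) * f (z - b%:Z) - f (z - 1 - a%:Z) * f (z + 1 + b%:Z)) +
      ((cbin r a)%:R * (cbin (m - r) b.+1)%:R
       - (cbin r a.+1)%:R * (cbin (m - r) b)%:R) *
      (f (z + a%:Z) * f (z + 1 + b%:Z) - f (z - 1 - a%:Z) * f (z - b%:Z)))).
    apply: eq_bigr => r _.
    have le_rm : (r <= m)%N by rewrite -ltnS.
    rewrite {1}(btrans_split z le_rm) (btrans_split_pred z le_rm).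
    rewrite (btrans_split (z + 1) (leq_subr r m)).
    (* Reading z as (z + 1) - 1 gives the same values of f as the splitting at z + 1. *)
    rewrite -[in btrans (m - r) z](addrK 1 z).
    rewrite (btrans_split_pred (z + 1) (leq_subr r m)) addrK.
    rewrite !big_distrlr -sumrB; apply: eq_bigr => a _.
    by rewrite -sumrB; apply: eq_bigr => b _ /=; ring.
  rewrite exchange_big; apply: eq_bigr => a _ /=.
  rewrite exchange_big; apply: eq_bigr => b _ /=.
  rewrite big_split /= -!mulr_suml !sumrB.
  have conv x y :
      \sum_(r < m.+1) (cbin r x)%:R * (cbin (m - r) y)%:R
      = (cbin_conv m x y)%:R :> R.
    by rewrite natr_sum; apply: eq_bigr => r _; rewrite natrM.
  (* Products of two upper or two lower values cancel once summed over r. *)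
  by rewrite !conv (cbin_conv_shift m a b) subrr mul0r addr0.
(* As [d] is symmetric, a and b may be swapped in the subtracted sum; then [f_lc] applies
   termwise. *)
have -> : \sum_(a < m.+1) \sum_(b < m.+1) d a b *
     (f (z + a%:Z) * f (z - b%:Z) - f (z - 1 - a%:Z) * f (z + 1 + b%:Z)) =
  \sum_(a < m.+1) \sum_(b < m.+1) d a b *
     (f (z + a%:Z) * f (z - b%:Z) - f (z + 1 + a%:Z) * f (z - 1 - b%:Z)).
  under eq_bigr do (under eq_bigr do rewrite mulrBr; rewrite sumrB).
  under [RHS]eq_bigr do (under eq_bigr do rewrite mulrBr; rewrite sumrB).
  rewrite !sumrB; congr (_ - _); rewrite exchange_big.
  apply: eq_bigr => a _; apply: eq_bigr => b _ /=.
  by rewrite /d !(cbin_convC m b) !(cbin_convC m b.+1) [f (z - 1 - _) * _]mulrC.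
apply: sumr_ge0 => a _; apply: sumr_ge0 => b _.
by rewrite mulr_ge0 ?subr_ge0 ?ler_nat ?cbin_conv_decr.
Qed.

End BinomialTransform.

(** * Rows of Pascal's triangle as functions on Z *)

Definition binz (R : nzRingType) (n : nat) (z : int) : R :=
  if z is Posz k then 'C(n, k)%:R else 0.

(** The ratio C(n, k+1) / C(n, k) = (n - k) / (k + 1) decreases for k <= n. *)
Lemma binz_lc (R : realDomainType) n (z : int) (a b : nat) :
  binz R n (z + 1 + a%:Z) * binz R n (z - 1 - b%:Z)
  <= binz R n (z + a%:Z) * binz R n (z - b%:Z).
Proof.
have binz_ge0 x : 0 <= binz R n x by case: x => k /=.
case E: (z - 1 - b%:Z) => [j|j]; last by rewrite mulr0 mulr_ge0.
have -> : z - b%:Z = j.+1%:Z by lia.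
have -> : z + a%:Z = (j.+1 + b + a)%N%:Z by lia.
have -> : z + 1 + a%:Z = (j.+1 + b + a).+1%N%:Z by lia.
rewrite /= -!natrM ler_nat; set i := (_ + a)%N.
have lt_ji : (j < i)%N by rewrite /i; lia.
have [le_nj|lt_jn] := leqP n j.
  by rewrite (@bin_small n i.+1) ?mul0n //; lia.
rewrite -(@leq_pmul2l (i.+1 * (n - j))); last by rewrite muln_gt0 subn_gt0.
have -> : (i.+1 * (n - j) * ('C(n, i.+1) * 'C(n, j)))%N
  = ((i.+1 * 'C(n, i.+1)) * ((n - j) * 'C(n, j)))%N by ring.
rewrite mul_bin_left -(mul_bin_left n j).
have -> : ((n - i) * 'C(n, i) * (j.+1 * 'C(n, j.+1)))%N
  = ((n - i) * j.+1 * ('C(n, i) * 'C(n, j.+1)))%N by ring.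
rewrite leq_mul2r [((n - i) * _)%N]mulnC; apply/orP; right.
by apply: leq_mul; lia.
Qed.

Lemma binzS (R : nzRingType) n z : binz R n.+1 z = binz R n z + binz R n (z - 1).
Proof.
case: z => [[|k]|k]; first by rewrite /= !bin0 addr0.
  by rewrite (_ : k.+1%:Z - 1 = k) /= ?binS ?natrD //; lia.
by rewrite (_ : Negz k - 1 = Negz k.+1) /= ?addr0 //; lia.
Qed.

(** Vandermonde's identity; since [binz] is 0 at negative arguments, i needs no cutoff at z. *)
Lemma binzD (R : nzRingType) n N z :
  binz R (n + N) z = \sum_(i < N.+1) 'C(N, i)%:R * binz R n (z - i%:Z).
Proof.
elim: N n z => [|N IH] n z; first by rewrite big_ord1 mul1r addn0 subr0.
rewrite addnS -addSn IH.
under eq_bigr do rewrite binzS mulrDr.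
rewrite big_split [RHS]big_ord_recl /=.
under [X in _ = _ + X]eq_bigr => i _ do
  rewrite /bump /= add1n binS natrD mulrDl.
rewrite big_split /= addrA; congr (_ + _); last first.
  by apply: eq_bigr => i _; congr (_ * binz _ _ _); lia.
rewrite big_ord_recl [in RHS]big_ord_recr /= (bin_small (ltnSn N)) mul0r addr0.
by rewrite !bin0 !addr0.
Qed.

(** On coefficients, B^r is multiplication by x^(-r) (1 + x)^(2r). *)
Lemma binz_btrans (R : realDomainType) n r z :
  binz R (n + 2 * r) (z + r%:Z) = btrans (binz R n) r z.
Proof. exact: binzD. Qed.

(** * Weighted sums along antidiagonals *)

(* Abel summation from the middle of each window outwards. *)
Lemma window_sum_ge0 (R : realDomainType) (m : nat) (g : nat -> R)
    (e : nat -> nat -> R) :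
  (forall i, 0 <= g i) ->
  (forall i, (m < i)%N -> g i = 0) ->
  (forall i d, g i * g (i + d).+1 <= g i.+1 * g (i + d)%N) ->
  (forall i d, (i + d <= m)%N -> 0 <= \sum_(r < d.+1) e (i + r)%N (i + d - r)%N) ->
  forall i d,
  0 <= \sum_(r < d.+1) g (i + r)%N * g (i + d - r)%N * e (i + r)%N (i + d - r)%N.
Proof.
move=> g_ge0 g_eq0 g_lc e_ge0.
pose E i d := \sum_(r < d.+1) e (i + r)%N (i + d - r)%N.
pose D i d :=
  \sum_(r < d.+1) g (i + r)%N * g (i + d - r)%N * e (i + r)%N (i + d - r)%N.
(* Strengthened for an induction on d in steps of two: within the range, the weighted sum is at
   least the outermost weight times the plain sum. *)
suff H d i : 0 <= D i d /\ ((i + d <= m)%N -> g i * g (i + d)%N * E i d <= D i d).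
  by move=> i d; case: (H d i).
have peel (F : nat -> nat -> R) j c :
    \sum_(r < c.+3) F (j + r)%N (j + c.+2 - r)%N =
    F j (j + c.+2)%N + \sum_(r < c.+1) F (j.+1 + r)%N (j.+1 + c - r)%N
    + F (j + c.+2)%N j.
  rewrite big_ord_recl big_ord_recr /= addrA addn0 subn0; congr (_ + _ + _).
    by apply: eq_bigr => r _; rewrite /bump /=; congr F; lia.
  by rewrite /bump /=; congr F; lia.
have DE j c : (j + c <= m)%N -> g j * g (j + c)%N * E j c <= D j c -> 0 <= D j c.
  by move=> le; apply: le_trans; rewrite mulr_ge0 ?mulr_ge0 ?e_ge0.
have out j c : (m < j + c.+2)%N -> D j c.+2 = D j.+1 c.
  by move=> lt; rewrite /D (peel (fun x y => g x * g y * e x y))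
    (g_eq0 _ lt) mulr0 !mul0r add0r addr0.
have [c] := ubnP d; elim: c d i => // c IH [|[|d]] i lt.
- have [le|lt'] := leqP (i + 0) m.
    have le' : g i * g (i + 0)%N * E i 0 <= D i 0.
      by rewrite /E /D !big_ord1 !addn0 !subn0.
    by split=> //; exact: DE le'.
  rewrite addn0 in lt' *.
  by split=> [|]; [rewrite /D big_ord1 addn0 subn0 g_eq0 ?mul0r | lia].
- have [le|lt'] := leqP (i + 1) m.
    have le' : g i * g (i + 1)%N * E i 1 <= D i 1.
      rewrite /E /D !big_ord_recl !big_ord0 /= /bump /= !addn0 !subn0 addnK.
      by rewrite mulrDr [g (i + 1)%N * g i]mulrC !addr0.
    by split=> //; exact: DE le'.
  split=> [|//]; rewrite /D !big_ord_recl big_ord0 /= /bump /= !addn0 !subn0 addnK.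
  by rewrite (g_eq0 _ lt') mulr0 !mul0r !addr0.
- have [IH0 IH1] : 0 <= D i.+1 d /\
      ((i.+1 + d <= m)%N -> g i.+1 * g (i.+1 + d)%N * E i.+1 d <= D i.+1 d).
    by apply: IH; lia.
  have [le|lt'] := leqP (i + d.+2) m; last by split=> [|//]; rewrite out.
  have le' : g i * g (i + d.+2)%N * E i d.+2 <= D i d.+2.
    rewrite /D /E (peel (fun x y => g x * g y * e x y)) (peel e) -/(D _ _) -/(E _ _).
    rewrite !mulrDr [g (i + _)%N * g i]mulrC lerD2r lerD2l.
    (* The inner plain sum is nonnegative, so its weight may be lowered to the outer one by
       [g_lc]. *)
    apply: le_trans (IH1 _); last lia.
    apply: ler_wpM2r; first by apply: e_ge0; lia.
    by have := g_lc i d.+1; rewrite !addnS addSn.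
  by split=> //; exact: DE le'.
Qed.

(** Induction on d; the absence of internal zeros permits division by the coefficients in
    between. *)
Lemma log_concave_spread (R : realFieldType) (p : {poly R}) :
  log_concave p -> no_internal_zeros p ->
  forall i d, p`_i * p`_(i + d).+1 <= p`_i.+1 * p`_(i + d).
Proof.
case=> p_ge0 lc niz i.
have lc1 j : p`_j * p`_j.+2 <= p`_j.+1 ^+ 2.
  have [lt|le] := ltnP j.+2 (size p); first by apply: (lc j.+1); rewrite /= ltn_predRL.
  by rewrite (nth_default _ le) mulr0 sqr_ge0.
elim=> [|d IH]; first by rewrite addn0 mulrC.
rewrite addnS.
have [->|nz] := eqVneq (p`_i * p`_(i + d).+2) 0; first by rewrite mulr_ge0.
have pos k : (i <= k <= (i + d).+2)%N -> 0 < p`_k.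
  by move=> ik; rewrite lt_neqAle p_ge0 eq_sym (niz i (i + d).+2) //; lia.
have p1 : 0 < p`_(i + d) by apply: pos; lia.
have p2 : 0 < p`_(i + d).+1 by apply: pos; lia.
(* After this scaling the claim is the induction hypothesis times [lc1] at i + d. *)
rewrite -(ler_pM2r (mulr_gt0 p1 p2)).
apply: (le_trans (y := (p`_i.+1 * p`_(i + d)) * p`_(i + d).+1 ^+ 2)); last first.
  by rewrite le_eqVlt; apply/orP; left; apply/eqP; ring.
have -> : p`_i * p`_(i + d).+2 * (p`_(i + d) * p`_(i + d).+1)
  = (p`_i * p`_(i + d).+1) * (p`_(i + d) * p`_(i + d).+2) by ring.
by apply: ler_pM => //; rewrite mulr_ge0.
Qed.

(** * Coefficients of the gamma expansion *)

Section GammaExpansion.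
Variables (R : realFieldType) (n : nat) (h gamma : {poly R}).
Hypothesis h_gamma : is_gamma_polynomial n h gamma.

Definition gcoef (i k : nat) : R := ('X^i * (1 + 'X) ^+ (n - 2 * i))`_k.

Lemma gcoefE i k :
  gcoef i k = if (k < i)%N then 0 else 'C(n - 2 * i, k - i)%:R.
Proof. by rewrite /gcoef coefXnM coef_1DXn. Qed.

Lemma gcoef_ge0 i k : 0 <= gcoef i k.
Proof. by rewrite gcoefE; case: ifP. Qed.

Lemma gcoef_binz i k : gcoef i k = binz R (n - 2 * i) (k%:Z - i%:Z).
Proof.
rewrite gcoefE; case: ltnP => [lt|le].
  by rewrite (_ : k%:Z - i%:Z = Negz (i - k).-1) //; lia.
by rewrite (_ : k%:Z - i%:Z = (k - i)%N%:Z) //; lia.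
Qed.

Lemma coef_gamma_expansion k : h`_k = \sum_(i < n./2.+1) gamma`_i * gcoef i k.
Proof.
case: h_gamma => _ {1}->; rewrite coef_sum.
by apply: eq_bigr => i _; rewrite coefZ.
Qed.

(** For i = j - r, n - 2i = (n - 2j) + 2r and k - i = (k - j) + r; so one row serves a whole window
    ending at j. *)
Lemma gcoef_btrans j r k : (j <= n./2)%N -> (r <= j)%N ->
  gcoef (j - r) k = btrans (binz R (n - 2 * j)) r (k%:Z - j%:Z).
Proof.
move=> le_jn le_rj; rewrite gcoef_binz -binz_btrans; congr (binz _ _ _); lia.
Qed.

Lemma gcoef_window_ge0 k i d : (i + d <= n./2)%N ->
  0 <= \sum_(r < d.+1)
     (gcoef (i + r) k.+1 * gcoef (i + d - r) k.+1
      - gcoef (i + r) k.+2 * gcoef (i + d - r) k).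
Proof.
move=> le; pose z := k.+1%:Z - (i + d)%N%:Z.
have := @btrans_conv_ge R _ (@binz_lc R (n - 2 * (i + d))) d z.
congr (0 <= _); apply: eq_bigr => r _.
have le_rd : (r <= d)%N by rewrite -ltnS.
rewrite (_ : i + r = i + d - (d - r))%N; last lia.
rewrite !gcoef_btrans //; try lia.
rewrite (_ : k.+2%:Z - _ = z + 1); last by rewrite /z; lia.
rewrite (_ : k%:Z - _ = z - 1); last by rewrite /z; lia.
by rewrite mulrC [btrans _ r (z - 1) * _]mulrC.
Qed.

(** x^i (1 + x)^(n-2i) has support [i, n - i]; these intervals are nested, and nonnegative terms
    cannot cancel. *)
Lemma gamma_expansion_niz : (forall i, 0 <= gamma`_i) -> no_internal_zeros h.
Proof.
move=> g_ge0.
have wit k : h`_k != 0 ->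
    exists2 i, gamma`_i != 0 & (i <= k <= n - i)%N && (i <= n./2)%N.
  rewrite coef_gamma_expansion => nz.
  have /existsP[i] : [exists i : 'I_n./2.+1, gamma`_i * gcoef i k != 0].
    apply: contraNT nz => /existsPn z; rewrite big1 // => i _.
    by apply/eqP; have := z i; rewrite negbK.
  rewrite mulf_eq0 negb_or gcoefE => /andP[gi].
  case: ltnP => [_|le_ik]; first by rewrite eqxx.
  rewrite pnatr_eq0 -lt0n bin_gt0 => le.
  by exists (i : nat) => //; have := ltn_ord i; lia.
have nz i k : gamma`_i != 0 -> (i <= n./2)%N -> (i <= k <= n - i)%N -> h`_k != 0.
  move=> gi le_in ik; rewrite coef_gamma_expansion.
  have lt_in : (i < n./2.+1)%N by [].
  rewrite (bigD1 (Ordinal lt_in)) //= lt0r_neq0 // ltr_pwDl //; last first.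
    by apply: sumr_ge0 => l _; rewrite mulr_ge0 ?gcoef_ge0.
  apply: mulr_gt0; first by rewrite lt0r gi g_ge0.
  case/andP: ik => le_ik le_kn.
  by rewrite gcoefE ltnNge le_ik ltr0n bin_gt0; lia.
move=> i j lt_ij; rewrite mulf_eq0 negb_or => /andP[/wit[a ga la] /wit[b gb lb]].
(* The smaller of the two indices gives the larger interval, which contains k. *)
move=> k ik; have [le|lt] := leqP a b.
  by apply: (nz a) => //; lia.
by apply: (nz b) => //; lia.
Qed.

Lemma gamma_expansion_lc : (forall i, 0 <= gamma`_i) ->
  (forall i d, gamma`_i * gamma`_(i + d).+1 <= gamma`_i.+1 * gamma`_(i + d)) ->
  forall k, h`_k * h`_k.+2 <= h`_k.+1 ^+ 2.
Proof.
move=> g_ge0 g_spread k; rewrite -subr_ge0.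
(* An auxiliary variable collects the terms of h_k by index sum i + j. *)
pose p l : {poly R} := \poly_(i < n./2.+1) (gamma`_i * gcoef i l).
have pE l i : (p l)`_i = gamma`_i * gcoef i l.
  rewrite coef_poly; case: ltnP => // le.
  case: h_gamma => szg _; rewrite nth_default ?mul0r //; exact: leq_trans le.
have hE l : h`_l = (p l).[1].
  rewrite coef_gamma_expansion horner_poly.
  by apply: eq_bigr => i _; rewrite expr1n mulr1.
rewrite !hE expr2 [_.[1] * (p k.+2).[1]]mulrC -!hornerM -hornerN -hornerD horner_coef.
apply: sumr_ge0 => s _; rewrite expr1n mulr1 coefB !coefM -sumrB.
(* The antidiagonal of sum s is the window with i = 0 and d = s; indices above n/2 have gamma
   coefficient 0. *)
have := @window_sum_ge0 R n./2 (fun i => gamma`_i)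
  (fun i j => gcoef i k.+1 * gcoef j k.+1 - gcoef i k.+2 * gcoef j k)
  g_ge0 _ g_spread (gcoef_window_ge0 k) 0 s.
rewrite (_ : \sum_(r < s.+1) _ = \sum_(r < s.+1) ((p k.+1)`_r * (p k.+1)`_(s - r)
    - (p k.+2)`_r * (p k)`_(s - r))).
  apply=> i lt; rewrite nth_default //; case: h_gamma => szg _; exact: leq_trans lt.
by apply: eq_bigr => r _; rewrite !pE !add0n; ring.
Qed.

End GammaExpansion.

Theorem theorem1p3 (R : realFieldType) (n : nat) (h gamma : {poly R})
  (h_sym : symmetric_poly n h)
  (h_gamma : is_gamma_polynomial n h gamma)
  (gamma_lc : log_concave gamma)
  (gamma_niz : no_internal_zeros gamma) :
  log_concave h /\ no_internal_zeros h.
Proof.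
have g_ge0 := gamma_lc.1.
split; last exact: gamma_expansion_niz h_gamma g_ge0.
split=> [k|[//|k] _].
  rewrite (coef_gamma_expansion h_gamma).
  by apply: sumr_ge0 => i _; rewrite mulr_ge0 ?gcoef_ge0.
exact: (gamma_expansion_lc h_gamma g_ge0 (log_concave_spread gamma_lc gamma_niz)).
Qed.
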